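(* Let $\tau_0,\tau_1>0$, $n\ge1$, $\lambda_i>0$ with $\sum_{i=1}^n\lambda_i=1$, $a_i>0$, $m_i\in\mathbb R^d$, $\Sigma_i\in\mathbb S_{++}^d$, $\mu_i=\mathcal N(m_i,\Sigma_i)$, and let $s,\theta,A_i,\mathsf Z$ be as in the context. Set $Z_0=\sum_{i=1}^n\lambda_i a_i^\theta$ and $\pi_i=\lambda_i a_i^\theta/Z_0$. For every $\nu\in\mathcal G_d^1$, $$-s\log\frac{\mathsf Z(\nu)}{Z_0}=\min_{\omega\in\Delta_n}\Big\{\sum_{i=1}^n\omega_iA_i(\nu)+s\,\mathrm{KL}(\omega\mid\pi)\Big\},$$ where $\Delta_n=\{\omega\in[0,1]^n:\sum_i\omega_i=1\}$ and $\mathrm{KL}(\omega\mid\pi)=\sum_i\omega_i\log(\omega_i/\pi_i)$ with $0\log(0/\pi_i):=0$. The minimizer is unique and equals $$\omega_i(\nu)=\frac{\lambda_i a_i^\theta e^{-A_i(\nu)/s}}{\sum_{j=1}^n\lambda_j a_j^\theta e^{-A_j(\nu)/s}},\qquad i=1,\dots,n.$$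
   Context: $\mathbb S_{++}^d$ is the set of real symmetric positive-definite $d\times d$ matrices, and $\mathcal G_d^1=\{\mathcal N(m,\Sigma):m\in\mathbb R^d,\ \Sigma\in\mathbb S_{++}^d\}$. Put $s=\tau_0+\tau_1$, $\theta=\tau_0/s$. For $\mu,\nu\in\mathcal G_d^1$, $$\mathsf A(\mu,\nu)=\inf_{p,q\in\mathcal P(\mathbb R^d)}\{W_2^2(p,q)+\tau_0\mathrm{KL}(p\mid\mu)+\tau_1\mathrm{KL}(q\mid\nu)\},$$ where $\mathrm{KL}$ between probability measures is relative entropy ($+\infty$ when absolute continuity fails) and $W_2^2(p,q)\in[0,\infty]$ is the infimum of $\int|x-y|^2d\pi$ over couplings $\pi$ of $p,q$. Set $A_i(\nu)=\mathsf A(\mu_i,\nu)$ and $\mathsf Z(\nu)=\sum_{i=1}^n\lambda_i a_i^\theta e^{-A_i(\nu)/s}$. *)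

(* Defs.v *)
From HB Require Import structures.
From mathcomp Require Import all_boot all_order all_algebra.
From mathcomp Require Import all_classical all_reals all_analysis.

Set Implicit Arguments.
Unset Strict Implicit.
Unset Printing Implicit Defensive.

Import Order.TTheory GRing.Theory Num.Theory.
Import numFieldNormedType.Exports.

Local Open Scope classical_set_scope.
Local Open Scope ring_scope.

(* The library equips d-tuples with the product of the Borel sigma-algebras   *)
(* of the factors, which is the Borel sigma-algebra of R^d.                   *)
Notation Rd R d := (d.-tuple (measurableTypeR R)).

Section consRd.
Context {R : realType} (d : nat).

Definition consRd (z : measurableTypeR R * Rd R d) : Rd R d.+1 :=
  [the d.+1.-tuple _ of z.1 :: z.2].

Lemma measurable_consRd : measurable_fun setT consRd.
Proof. exact: measurable_cons. Qed.

Variable leb : {sigma_finite_measure set (Rd R d) -> \bar R}.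

Definition leb_cons : set (Rd R d.+1) -> \bar R :=
  pushforward (lebesgue_measure \x leb)%E consRd.

Let leb_cons0 : leb_cons set0 = 0%E.
Proof. by rewrite /leb_cons /pushforward preimage_set0 measure0. Qed.

Let leb_cons_ge0 A : (0 <= leb_cons A)%E.
Proof. by rewrite /leb_cons /pushforward measure_ge0. Qed.

Let leb_cons_sigma_additive : semi_sigma_additive leb_cons.
Proof.
have mc := measurable_consRd.
move=> F mF tF mUF; rewrite /leb_cons /pushforward preimage_bigcup.
apply: measure_semi_sigma_additive.
- by move=> n; rewrite -[X in measurable X]setTI; exact: mc.
- apply/trivIsetP => /= i j _ _ ij; rewrite -preimage_setI.
  by move/trivIsetP : tF => /(_ _ _ _ _ ij) ->//; rewrite preimage_set0.
- by rewrite -preimage_bigcup -[X in measurable X]setTI; exact: mc.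
Qed.

HB.instance Definition _ := isMeasure.Build _ _ _ leb_cons
  leb_cons0 leb_cons_ge0 leb_cons_sigma_additive.

Let leb_cons_sigma_finite : sigma_finite setT leb_cons.
Proof.
pose g (t : Rd R d.+1) : measurableTypeR R * Rd R d :=
  (tnth t ord0, [tuple of behead t]).
have mg : measurable_fun setT g.
  by apply: measurable_fun_pair; [exact: measurable_tnth|exact: measurable_behead].
have gK : cancel consRd g by move=> [x t]; congr pair; exact/val_inj.
have /sigma_finiteP[F [TF ndF Foo]] :=
  sigma_finiteT (@lebesgue_measure R).
have /sigma_finiteP[G [TG ndG Goo]] := sigma_finiteT leb.
exists (fun n => g @^-1` (F n `*` G n)).
  rewrite predeqE => t; split => // _.
  have [k _ Fk] : (\bigcup_k F k) (g t).1 by rewrite -TF.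
  have [l _ Gl] : (\bigcup_k G k) (g t).2 by rewrite -TG.
  exists (maxn k l) => //; split.
  - by move: Fk; exact/subsetPset/ndF/leq_maxl.
  - by move: Gl; exact/subsetPset/ndG/leq_maxr.
move=> n; have [? ?] := Foo n; have [? ?] := Goo n; split.
  by rewrite -[X in measurable X]setTI; apply: mg => //; exact: measurableX.
rewrite /leb_cons /pushforward (_ : consRd @^-1` _ = F n `*` G n).
  by rewrite product_measure1E// lte_mul_pinfty// ge0_fin_numE.
by rewrite -comp_preimage (_ : g \o consRd = id) ?preimage_id //; exact/funext.
Qed.

HB.instance Definition _ := Measure_isSigmaFinite.Build _ _ _ leb_cons
  leb_cons_sigma_finite.

End consRd.

(* Lebesgue measure on R^d, as a d-fold product measure.                      *)
Fixpoint lebesgue_Rd (R : realType) (d : nat) :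
    {sigma_finite_measure set (Rd R d) -> \bar R} :=
  match d with
  | 0 => \d_([tuple] : Rd R 0)
  | d'.+1 => leb_cons (lebesgue_Rd R d')
  end.

Section gaussian.
Context {R : realType} {d : nat}.
Implicit Types (x y : Rd R d) (m : 'rV[R]_d) (S : 'M[R]_d).

Definition vec x : 'rV[R]_d := \row_i tnth x i.

Definition posdef S : Prop :=
  S^T = S /\ forall v : 'rV[R]_d, v != 0 -> 0 < (v *m S *m v^T) 0 0.

Definition gaussian_pdf m S x : R :=
  (Num.sqrt ((pi *+ 2) ^+ d * \det S))^-1 *
  expR (- ((vec x - m) *m invmx S *m (vec x - m)^T) 0 0 / 2).

Definition is_gaussian m S (mu : probability (Rd R d) R) : Prop :=
  forall B, measurable B ->
    mu B = (\int[lebesgue_Rd R d]_(x in B) (gaussian_pdf m S x)%:E)%E.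

Definition nondegenerate_gaussian : set (probability (Rd R d) R) :=
  [set mu | exists m S, posdef S /\ is_gaussian m S mu].

End gaussian.

Section transport.
Context {R : realType} {d : nat}.
Implicit Types p q mu nu : probability (Rd R d) R.
Local Open Scope charge_scope.
Local Open Scope ereal_scope.

Definition sqdist (x y : Rd R d) : R :=
  (\sum_(i < d) (tnth x i - tnth y i) ^+ 2)%R.

Definition coupling p q : set (probability (Rd R d * Rd R d)%type R) :=
  [set g | forall B, measurable B ->
     g (B `*` setT) = p B /\ g (setT `*` B) = q B].

Definition W2sq p q : \bar R :=
  ereal_inf [set \int[g]_z (sqdist z.1 z.2)%:E | g in coupling p q].

(* The integrand is f * ln f with f = dp/dmu; ln 0 = 0 gives 0 * ln 0 = 0.     *)
Definition KL p mu : \bar R :=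
  if `[< p `<< mu >] then
    \int[mu]_x (let f := fine ('d (charge_of_finite_measure p) '/d mu x) in
                (f * ln f)%R)%:E
  else +oo.

Definition penalizedW (tau0 tau1 : R) mu nu : \bar R :=
  ereal_inf [set W2sq pq.1 pq.2 + tau0%:E * KL pq.1 mu + tau1%:E * KL pq.2 nu
            | pq in [set: probability (Rd R d) R * probability (Rd R d) R]].

End transport.

Section simplex.
Context {R : realType} {n : nat}.

Definition simplex : set ('I_n -> R) :=
  [set w | (forall i, 0 <= w i <= 1) /\ \sum_(i < n) w i = 1].

(* w i = 0 contributes 0, whatever the value of ln 0.                         *)
Definition discreteKL (w p : 'I_n -> R) : R := \sum_(i < n) w i * ln (w i / p i).

End simplex.

Definition minimizer (R : realType) T (D : set T) (F : T -> \bar R) (x : T) :=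
  D x /\ forall y, D y -> (F x <= F y)%E.

Definition is_min (R : realType) T (D : set T) (F : T -> \bar R) (v : \bar R) :=
  exists2 x, minimizer D F x & F x = v.

(* Main.v *)
(* Completing the entropy: with c_i = lambda_i a_i^theta and b_i = c_i e^(-A_i/s),
   the objective equals -s log(Z/Z0) + s KL(w | b/Z), so everything follows from
   Gibbs' inequality and its equality case, once every A_i(nu) is a real number.
   For the latter, x ln x >= -1 bounds the penalties below; for the upper bound,
   condition mu and nu on balls of positive mass: the conditioned measures have
   bounded support, hence finite W2 through the product coupling, and each has a
   density that is constant on its ball, hence finite relative entropy. *)
Require Import Defs.
From mathcomp Require Import all_boot all_order all_algebra.
From mathcomp Require Import all_classical all_reals all_analysis.
From mathcomp Require Import measurable_realfun ring lra.

Set Implicit Arguments.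
Unset Strict Implicit.
Unset Printing Implicit Defensive.

Import Order.TTheory GRing.Theory Num.Theory.
Import numFieldNormedType.Exports.
Local Open Scope classical_set_scope.
Local Open Scope ring_scope.

(** * Gibbs' inequality on the simplex and the change of reference weights *)

Lemma mul_ln_ge_sub (R : realType) (x y : R) : 0 <= x -> 0 < y ->
  x - y <= x * ln (x / y) ?= iff (x == y).
Proof.
move=> x0 y0; apply/leifP; have [->|xy] := eqVneq x y.
  by rewrite divff ?lt0r_neq0// ln1 mulr0 subrr.
move: x0; rewrite le_eqVlt => /predU1P[<-|x0].
  by rewrite mul0r sub0r oppr_lt0.
have yx : 0 < y / x by rewrite divr_gt0.
have xyE : x / y = (y / x)^-1 by rewrite invf_div.
have : ln (y / x) != 0.
  rewrite ln_eq0//; apply: contra_neq xy => /(congr1 ( *%R^~ x)).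
  by rewrite mul1r divfK ?gt_eqF// => ->.
(* The strict bound 1 + u < e^u for nonzero u, taken at u = ln (y / x) and multiplied by x. *)
move=> /expR_gt1Dx; rewrite lnK ?posrE// => h.
rewrite xyE lnV ?posrE// -(ltr_pM2l x0) mulrCA divff ?gt_eqF// in h *.
by lra.
Qed.

(** Both families have mass 1, so 0 is the sum of the w i - r i, and the termwise bound can be
    summed; [leif_sum] carries the equality cases along. *)
Lemma discreteKL_ge0 (R : realType) (n : nat) (w r : 'I_n -> R) :
  simplex w -> (forall i, 0 < r i) -> \sum_(i < n) r i = 1 ->
  0 <= discreteKL w r ?= iff [forall i, w i == r i].
Proof.
move=> [w01 w1] r0 r1.
rewrite -[0](subrr 1) -[in X in X - _]w1 -r1 -sumrB /discreteKL.
apply: leif_sum => i _; apply: mul_ln_ge_sub => //.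
by have /andP[] := w01 i.
Qed.

Lemma psumr_ord_gt0 (R : realType) (n : nat) (f : 'I_n -> R) :
  (0 < n)%N -> (forall i, 0 < f i) -> 0 < \sum_(i < n) f i.
Proof.
case: n f => // n f _ f0.
by rewrite big_ord_recl ltr_pwDl// sumr_ge0// => i _; exact/ltW.
Qed.

(** Termwise this is ln (b i / Z) = ln (c i / C) - al i / s - ln (Z / C); since w has mass 1, the
    constant - s ln (Z / C) may be averaged against w. *)
Lemma discreteKL_change (R : realType) (n : nat) (s : R) (al c w : 'I_n -> R) :
    0 < s -> (forall i, 0 < c i) -> (0 < n)%N -> simplex w ->
  let C := \sum_(i < n) c i in
  let b i := c i * expR (- al i / s) in
  let Z := \sum_(i < n) b i in
  \sum_(i < n) w i * al i + s * discreteKL w (fun i => c i / C) =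
  - s * ln (Z / C) + s * discreteKL w (fun i => b i / Z).
Proof.
move=> s0 c0 n0 [w01 w1] C b Z.
have b0 i : 0 < b i by rewrite mulr_gt0// expR_gt0.
have C0 : 0 < C by exact: psumr_ord_gt0.
have Z0 : 0 < Z by exact: psumr_ord_gt0.
have -> : - s * ln (Z / C) = \sum_(i < n) w i * (- s * ln (Z / C)).
  by rewrite -mulr_suml w1 mul1r.
rewrite /discreteKL !mulr_sumr -!big_split/=; apply: eq_bigr => i _.
(* Terms with w i = 0 are treated apart, because the logarithm of a quotient splits only for
   positive arguments. *)
have /andP[] := w01 i; rewrite le_eqVlt => /predU1P[<- _|wi _].
  by rewrite !mul0r mulr0 addr0.
rewrite !ln_div ?posrE ?divr_gt0// {1}/b lnM ?posrE ?expR_gt0// expRK.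
by field; rewrite gt_eqF.
Qed.

(** * Entropy integrals: a lower bound, and finiteness for conditioned measures *)

Section relative_entropy.
Context {disp : measure_display} {T : measurableType disp} {R : realType}.
Implicit Types (p mu : probability T R) (B : set T) (f : T -> R).
Local Open Scope charge_scope.
Local Open Scope ereal_scope.

Lemma measurable_mul_ln f : measurable_fun setT f ->
  measurable_fun setT (fun x => f x * ln (f x))%R.
Proof.
move=> mf; apply: measurable_funM => //.
exact: measurableT_comp (@measurable_ln R) mf.
Qed.

(** The integrand is at least -1 and [mu] has mass 1, so the negative part has integral at most 1;
    the positive part may have infinite integral. *)
Lemma integral_mul_ln_geN1 mu f : measurable_fun setT f ->
  (-1)%:E <= \int[mu]_x (f x * ln (f x))%R%:E.
Proof.
move=> mf; set F : T -> R := fun x => (f x * ln (f x))%R.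
have F_ge x : (-1 <= F x)%R.
  (* At nonpositive values of f the convention [ln] = 0 makes the integrand vanish. *)
  rewrite /F; have [f0|f0] := leP (f x) 0%R.
    by rewrite ln0// mulr0 lerN10.
  have [] := @mul_ln_ge_sub R _ 1 (ltW f0) ltr01.
  by rewrite divr1 => + _; lra.
have mF : measurable_fun setT F by exact: measurable_mul_ln.
have : \int[mu]_x (fun x => (F x)%:E)^\- x <= \int[mu]_x (cst 1 x).
  apply: ge0_le_integral => //.
  - by apply: measurable_funeneg; exact/measurable_EFinP.
  - move=> x _ /=; rewrite funenegE -EFinN -EFin_max lee_fin ge_max ler01.
    by rewrite andbT lerNl F_ge.
rewrite integral_cst//= mul1e probability_setT => nle1.
have p0 : 0 <= \int[mu]_x (fun x => (F x)%:E)^\+ x by exact: integral_ge0.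
by rewrite integralE; apply: le_trans (leeB p0 nle1); rewrite sub0e.
Qed.

Lemma conditioned mu B : measurable B -> 0 < mu B ->
  exists p, forall A, p A = mu (A `&` B) * (fine (mu B))^-1%:E.
Proof.
(* [mnormalize] falls back on its second argument only for total mass 0 or +oo, and mu B is positive
   and finite. *)
move=> mB B0; exists (mnormalize (mrestr mu mB) mu) => A.
rewrite /= /mnormalize /= /mrestr setTI gt_eqF//=.
by rewrite lt_eqF// (le_lt_trans (probability_le1 _ _)) ?ltry.
Qed.

Lemma conditioned_full p mu B : measurable B -> 0 < mu B ->
  (forall A, p A = mu (A `&` B) * (fine (mu B))^-1%:E) -> p B = 1.
Proof.
move=> mB B0 ->; have fB : mu B \is a fin_num by rewrite fin_num_measure.
rewrite setIid -{1}(fineK fB) -EFinM divff// gt_eqF// fine_gt0// B0/=.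
by rewrite -ge0_fin_numE.
Qed.

Lemma conditioned_dominates p mu B : measurable B ->
  (forall A, p A = mu (A `&` B) * (fine (mu B))^-1%:E) -> p `<< mu.
Proof.
move=> mB pE; apply/null_content_dominatesP => A mA muA0; rewrite pE.
by rewrite (@subset_measure0 _ _ _ mu _ A)// ?mul0e//; exact: measurableI.
Qed.

(** Both functions have integral p E over every measurable set E, hence agree almost everywhere. *)
Lemma conditioned_Radon_Nikodym p mu B : measurable B -> 0 < mu B ->
  (forall A, p A = mu (A `&` B) * (fine (mu B))^-1%:E) ->
  ae_eq mu setT ('d (charge_of_finite_measure p) '/d mu)
    (fun x => ((fine (mu B))^-1 * \1_B x)%R%:E).
Proof.
move=> mB B0 pE; have pmu := conditioned_dominates mB pE.
have mg : measurable_fun setT (fun x => (fine (mu B))^-1 * \1_B x : R)%R.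
  by apply: measurable_funM => //; exact: measurable_indic.
apply: integral_ae_eq => //.
- exact: Radon_Nikodym_integrable.
- exact/measurable_EFinP.
- move=> E _ mE; rewrite -Radon_Nikodym_integral//.
  under eq_integral do rewrite EFinM.
  rewrite ge0_integralZl//; last 2 first.
  + by apply/measurable_EFinP; exact: measurable_indic.
  + by rewrite lee_fin invr_ge0 fine_ge0.
  + by rewrite integral_indic// setIC muleC; exact: pE.
Qed.

(** With c = 1 / mu B the density is c on B and 0 elsewhere, so the integrand is almost everywhere c
    ln c on B and 0 off B; the integral is the real number c ln c mu B. *)
Lemma conditioned_entropy_lty p mu B : measurable B -> 0 < mu B ->
  (forall A, p A = mu (A `&` B) * (fine (mu B))^-1%:E) ->
  \int[mu]_x (let f := fine ('d (charge_of_finite_measure p) '/d mu x) in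
              (f * ln f)%R)%:E < +oo.
Proof.
move=> mB B0 pE; have pmu := conditioned_dominates mB pE.
have RN := conditioned_Radon_Nikodym mB B0 pE.
set f := 'd _ '/d mu in RN *; set c := ((fine (mu B))^-1)%R in pE RN.
have fi : mu.-integrable setT f by exact: Radon_Nikodym_integrable.
rewrite (@ae_eq_integral _ _ _ mu setT (fun x => (c * ln c)%:E * (\1_B x)%:E))//.
- rewrite integralZl//; last exact: integrable_indic.
  rewrite integral_indic// setIT ltey_eq.
  by rewrite fin_numM// fin_num_measure.
- apply/measurable_EFinP/measurable_mul_ln.
  by apply: measurableT_comp => //; exact: measurable_int fi.
- apply: measurable_funeM; apply/measurable_EFinP; exact: measurable_indic.
- apply: filterS RN => x /= /(_ Logic.I) -> _ /=.
  rewrite indicE; case: (x \in B) => /=; first by rewrite mulr1 mule1.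
  by rewrite mulr0 mul0r mule0.
Qed.

End relative_entropy.

(** * Product measures as couplings *)

Section product_probability.
Context {d1 d2 : measure_display} {T1 : measurableType d1}
  {T2 : measurableType d2} {R : realType}.
Variables (P1 : probability T1 R) (P2 : probability T2 R).
Local Open Scope ereal_scope.

Lemma product_marginals (A : set T1) (B : set T2) :
  measurable A -> measurable B ->
  (P1 \x P2) (A `*` setT) = P1 A /\ (P1 \x P2) (setT `*` B) = P2 B.
Proof.
move=> mA mB; rewrite !product_measure1E//=.
by rewrite !probability_setT mule1 mul1e.
Qed.

Lemma product_setC_eq0 (A : set T1) (B : set T2) :
  measurable A -> measurable B -> P1 A = 1 -> P2 B = 1 ->
  (P1 \x P2) (~` (A `*` B)) = 0.
Proof.
move=> mA mB A1 B1.
have AB1 : (P1 \x P2) (A `*` B) = 1 by rewrite product_measure1E//= A1 B1 mule1.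
rewrite (probability_setC (P1 \x P2) (measurableX mA mB)).
by rewrite [X in _ - X]AB1 subee.
Qed.

End product_probability.

(** * Finiteness of the penalized transport cost *)

Section transport_cost.
Context {R : realType} {d : nat}.
Implicit Types p q mu nu : probability (Rd R d) R.

Definition sqnorm (x : Rd R d) : R := \sum_(i < d) tnth x i ^+ 2.

Lemma sqdist_le (x y : Rd R d) : sqdist x y <= 2 * sqnorm x + 2 * sqnorm y.
Proof.
rewrite !mulr_sumr -big_split/=; apply: ler_sum => i _.
(* The two sides differ by the square of the sum of the coordinates. *)
by have := sqr_ge0 (tnth x i + tnth y i); nra.
Qed.

Lemma measurable_sqnorm : measurable_fun setT sqnorm.
Proof.
apply: measurable_sum => i; apply: measurable_funX; exact: measurable_tnth.
Qed.

Lemma measurable_sqdist :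
  measurable_fun setT (fun z : Rd R d * Rd R d => sqdist z.1 z.2).
Proof.
apply: measurable_sum => i; apply: measurable_funX; apply: measurable_funB.
- exact: (measurableT_comp (measurable_tnth i) measurable_fst).
- exact: (measurableT_comp (measurable_tnth i) measurable_snd).
Qed.

(** The closed Euclidean ball of radius sqrt k about 0; integer bounds on the squared norm give a
    countable cover of the space. *)
Definition sqball (k : nat) : set (Rd R d) := [set x | sqnorm x <= k%:R].

Lemma measurable_sqball k : measurable (sqball k).
Proof.
rewrite -[sqball k]setTI.
by have := measurable_sqnorm measurableT (measurable_itv `]-oo, k%:R]).
Qed.

(** If all these balls were null, so would be their countable union, which is the whole space and
    has mass 1. *)
Lemma sqball_mass_gt0 mu : exists k, (0 < mu (sqball k))%E.
Proof.
apply: contrapT => /forallNP h.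
have mu0 k : mu (sqball k) = 0%E.
  by apply/eqP; rewrite eq_le measure_ge0 andbT leNgt; apply/negP/h.
have cover : \bigcup_k sqball k = setT.
  apply/seteqP; split=> // x _; exists (Num.truncn (sqnorm x)).+1 => //.
  by rewrite /sqball/= ltW// truncnS_gt.
have : mu.-negligible (\bigcup_k sqball k).
  apply: negligible_bigcup => k.
  by apply/negligibleP; [exact: measurable_sqball|exact: mu0].
rewrite cover => /(negligibleP _ measurableT).
move=> h0; have := probability_setT mu; rewrite h0 => /esym/eqP.
by rewrite onee_eq0.
Qed.

Local Open Scope charge_scope.
Local Open Scope ereal_scope.

Lemma KL_geN1 p mu : (-1)%:E <= KL p mu.
Proof.
rewrite /KL; case: asboolP => [pmu|_]; last exact: leey.
apply: integral_mul_ln_geN1.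
apply: measurableT_comp => //; exact: measurable_int (Radon_Nikodym_integrable _).
Qed.

Lemma KL_conditioned_lty p mu (B : set (Rd R d)) : measurable B -> 0 < mu B ->
  (forall A, p A = mu (A `&` B) * (fine (mu B))^-1%:E) -> KL p mu < +oo.
Proof.
move=> mB B0 pE; rewrite /KL asboolT; last exact: conditioned_dominates mB pE.
exact: conditioned_entropy_lty pE.
Qed.

Lemma W2sq_ge0 p q : 0 <= W2sq p q.
Proof.
apply: le_ereal_inf_tmp => _ [g _ <-]; apply: integral_ge0 => z _.
by rewrite lee_fin sumr_ge0// => i _; exact: sqr_ge0.
Qed.

Lemma product_coupling p q : coupling p q (p \x q).
Proof. by move=> B mB; exact: product_marginals. Qed.

(** The product coupling is concentrated on the product of the two balls, where [sqdist_le] bounds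
    the cost by 2k + 2l. *)
Lemma W2sq_sqball_lty p q k l :
  p (sqball k) = 1 -> q (sqball l) = 1 -> W2sq p q < +oo.
Proof.
move=> pk ql; pose M : R := (2 * k%:R + 2 * l%:R)%R.
have mk := measurable_sqball k; have ml := measurable_sqball l.
apply: (@le_lt_trans _ _ M%:E); last exact: ltry.
apply: ge_ereal_inf; exists (\int[p \x q]_z (sqdist z.1 z.2)%:E).
  by exists (p \x q)%E => //; exact: product_coupling.
apply: (@le_trans _ _ (\int[p \x q]_z M%:E)); last first.
  by rewrite integral_cst//= probability_setT mule1.
apply: ae_ge0_le_integral => //.
- by move=> z _; rewrite lee_fin sumr_ge0// => i _; exact: sqr_ge0.
- by apply/measurable_EFinP; have := measurable_sqdist.
- by move=> z _; rewrite lee_fin addr_ge0// mulr_ge0.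
- exists (~` (sqball k `*` sqball l)); split.
  + by apply: measurableC; exact: measurableX.
  + exact: product_setC_eq0.
  + move=> z /= + [zk zl]; apply => _; rewrite lee_fin.
    by apply: le_trans (sqdist_le _ _) _; rewrite lerD// ler_pM2l.
Qed.

Lemma penalizedW_fin_num (tau0 tau1 : R) mu nu :
  (0 < tau0)%R -> (0 < tau1)%R -> penalizedW tau0 tau1 mu nu \is a fin_num.
Proof.
move=> t0 t1.
(* Each competitor costs at least this much: the transport term is nonnegative and each entropy is
   at least -1. Any real lower bound serves here. *)
have lb : (- tau0 - tau1)%:E <= penalizedW tau0 tau1 mu nu.
  apply: le_ereal_inf_tmp => _ [[p q] _ <-] /=.
  rewrite EFinD; apply: leeD; last first.
    by rewrite -mulrN1 EFinM; apply: lee_wpmul2l; [rewrite lee_fin ltW|exact: KL_geN1].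
  rewrite -[leLHS]add0e; apply: leeD; first exact: W2sq_ge0.
  by rewrite -mulrN1 EFinM; apply: lee_wpmul2l; [rewrite lee_fin ltW|exact: KL_geN1].
have [k k0] := sqball_mass_gt0 mu; have [l l0] := sqball_mass_gt0 nu.
have mk := measurable_sqball k; have ml := measurable_sqball l.
have [p pE] := conditioned mk k0; have [q qE] := conditioned ml l0.
rewrite fin_real// (lt_le_trans _ lb) ?ltNyr//=.
(* The conditioned measures form one competitor, whose three terms are then bounded separately. *)
apply: (@le_lt_trans _ _ (W2sq p q + tau0%:E * KL p mu + tau1%:E * KL q nu)).
  by apply: ereal_inf_lbound; exists (p, q).
have klp := KL_conditioned_lty mk k0 pE.
have klq := KL_conditioned_lty ml l0 qE.
rewrite !lte_add_pinfty//.
- by apply: (@W2sq_sqball_lty _ _ k l); apply: conditioned_full; eauto.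
(* The lower bound excludes -oo, so the entropy is a real number and its multiple stays finite. *)
- by move: klp (KL_geN1 p mu); case: (KL p mu) => // r _ _; rewrite -EFinM ltry.
- by move: klq (KL_geN1 q nu); case: (KL q nu) => // r _ _; rewrite -EFinM ltry.
Qed.

End transport_cost.

(** * The variational formula and its unique minimizer *)

Theorem theorem3p2 (R : realType) (d n : nat) (tau0 tau1 : R)
    (lambda a : 'I_n -> R) (m : 'I_n -> 'rV[R]_d) (Sigma : 'I_n -> 'M[R]_d)
    (mu : 'I_n -> probability (Rd R d) R)
    (tau0_gt0 : 0 < tau0) (tau1_gt0 : 0 < tau1) (n_ge1 : (1 <= n)%N)
    (lambda_gt0 : forall i, 0 < lambda i) (lambda_sum1 : \sum_(i < n) lambda i = 1)
    (a_gt0 : forall i, 0 < a i) (Sigma_posdef : forall i, posdef (Sigma i))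
    (mu_gaussian : forall i, is_gaussian (m i) (Sigma i) (mu i)) :
  let s := tau0 + tau1 in
  let theta := tau0 / s in
  let A i nu := penalizedW tau0 tau1 (mu i) nu in
  let weight i nu : \bar R :=
    ((lambda i * a i `^ theta)%:E * expeR (- A i nu / s%:E))%E in
  let Z nu : \bar R := (\sum_(i < n) weight i nu)%E in
  let Z0 := \sum_(i < n) lambda i * a i `^ theta in
  let pi_ i := lambda i * a i `^ theta / Z0 in
  let objective nu (w : 'I_n -> R) : \bar R :=
    (\sum_(i < n) (w i)%:E * A i nu + (s * discreteKL w pi_)%:E)%E in
  let omega nu i : R := fine (weight i nu / Z nu)%E in
  forall nu, nondegenerate_gaussian nu ->
    is_min simplex (objective nu) (- s%:E * lne (Z nu / Z0%:E))%E /\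
    (forall w, minimizer simplex (objective nu) w <-> w = omega nu).
Proof.
move=> s theta A weight Z Z0 pi_ objective omega nu _.
have s0 : 0 < s by rewrite addr_gt0.
pose c i := lambda i * a i `^ theta.
have c0 i : 0 < c i by rewrite mulr_gt0// powR_gt0.
(* Finiteness of the costs lets the extended-real expressions be replaced by real ones from here
   on. *)
pose al i := fine (A i nu).
have AE i : A i nu = (al i)%:E by rewrite fineK//; exact: penalizedW_fin_num.
pose b i := c i * expR (- al i / s).
have b0 i : 0 < b i by rewrite mulr_gt0// expR_gt0.
have wE i : weight i nu = (b i)%:E.
  by rewrite /weight AE inver gt_eqF// -EFinN -EFinM/= -EFinM.
pose S := \sum_(i < n) b i.
have ZE : Z nu = S%:E by rewrite /Z (eq_bigr (EFin \o b))// sumEFin.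
have S0 : 0 < S by exact: psumr_ord_gt0.
have Z00 : 0 < Z0 by exact: psumr_ord_gt0.
pose om i := b i / S.
have om0 i : 0 < om i by rewrite divr_gt0.
have om1 : \sum_(i < n) om i = 1 by rewrite -mulr_suml divff ?gt_eqF.
have omE : omega nu = om.
  by apply/funext => i; rewrite /omega wE ZE inver gt_eqF.
have som : simplex om.
  split=> // i; rewrite ltW//= -om1 (bigD1 i)//= lerDl.
  by rewrite sumr_ge0// => j _; exact/ltW.
pose v := - s * ln (S / Z0).
have vE : (- s%:E * lne (Z nu / Z0%:E))%E = v%:E.
  by rewrite ZE inver gt_eqF// -EFinM lne_EFin ?divr_gt0// -EFinN -EFinM.
(* On the simplex the objective is a constant plus s times the relative entropy to [om]; minimizing
   it means minimizing that entropy. *)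
have objE w : simplex w -> objective nu w = (v + s * discreteKL w om)%:E.
  move=> sw; rewrite -(discreteKL_change al s0 c0 n_ge1 sw) EFinD -sumEFin.
  by congr (_ + _)%E; apply: eq_bigr => i _; rewrite AE.
have gibbs w : simplex w -> 0 <= discreteKL w om ?= iff [forall i, w i == om i].
  by move=> sw; exact: discreteKL_ge0.
have KLom : discreteKL om om = 0.
  by apply/esym/eqP; rewrite (gibbs _ som).2; apply/forallP.
have min_om : minimizer simplex (objective nu) om.
  split=> // w sw; rewrite !objE// lee_fin lerD2l ler_pM2l// KLom.
  exact: (gibbs _ sw).1.
split; first by exists om => //; rewrite objE// KLom mulr0 addr0 vE.
rewrite omE => w; split=> [[sw wmin]|->//].
apply/funext => i; apply/eqP; move: i; apply/forallP.
(* Comparing a minimizer with [om], whose entropy is 0, forces its entropy to be at most 0; the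
   equality case of Gibbs' inequality then identifies the two. *)
rewrite -(gibbs _ sw).2 eq_le (gibbs _ sw).1/=.
by have := wmin _ som; rewrite !objE// lee_fin lerD2l ler_pM2l// KLom.
Qed.
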